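(* Let $a_1,a_2,b_1,b_2$ be positive integers with $\gcd(a_1,a_2)=1$ and $\gcd(b_1,b_2)=1$, and let $$S=\langle (a_1,0),(a_2,0),(0,b_1),(0,b_2),(1,1)\rangle\subseteq\mathbb{N}^2.$$ Assume that $S$ has embedding dimension $5$ (i.e. the five listed elements are the minimal generators of $S$). Then $|\operatorname{FA}(S)|\geq 2$.
   Context: $\mathbb{N}$ is the set of nonnegative integers; $\langle A\rangle$ is the submonoid of $\mathbb{N}^d$ generated by $A$. A generalized numerical semigroup is a submonoid $S\subseteq\mathbb{N}^d$ whose set of gaps $\mathcal{H}(S)=\mathbb{N}^d\setminus S$ is finite (the $S$ in the claim is one, with $d=2$). Every generalized numerical semigroup has a unique minimal set of generators, which is finite; its cardinality is the embedding dimension. The natural partial order is $\mathbf{x}\leq_{\mathbb{N}^d}\mathbf{y}$ if and only if $\mathbf{y}-\mathbf{x}\in\mathbb{N}^d$, and $\operatorname{FA}(S)$ (the Frobenius-allowable elements) is the set of maximal elements of $\mathcal{H}(S)$ with respect to $\leq_{\mathbb{N}^d}$. *)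

(* Defs.v *)
From mathcomp Require Export all_boot all_algebra.
From mathcomp Require Export boolp classical_sets functions cardinality.

Set Implicit Arguments.
Unset Strict Implicit.
Unset Printing Implicit Defensive.

Import GRing.Theory.

Local Open Scope classical_set_scope.
Local Open Scope card_scope.
Local Open Scope ring_scope.

Definition vec2 (x y : nat) : 'rV[nat]_2 :=
  \row_(i < 2) (if i == ord0 then x else y).

Section Semigroups.
Variable d : nat.
Implicit Types (A S M : set 'rV[nat]_d) (x y z : 'rV[nat]_d).

Definition submonoid M := M 0 /\ forall x y, M x -> M y -> M (x + y).

Definition generated A : set 'rV[nat]_d := smallest submonoid A.

Definition minimal_generators S A :=
  generated A = S /\ forall B, B `<=` A -> generated B = S -> B = A.

(* A relation rather than a number: a submonoid of N^d has at most one minimal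
   set of generators, so at most one e is related to S. *)
Definition embedding_dimension S (e : nat) :=
  exists A, minimal_generators S A /\ A #= `I_e.

Definition gaps S : set 'rV[nat]_d := ~` S.

(* nat has no signed subtraction: "y - x belongs to N^d" says that some z in
   N^d satisfies y = x + z. *)
Definition le_Nd x y := exists z, y = x + z.

Definition FA S : set 'rV[nat]_d :=
  [set x | gaps S x /\ forall y, gaps S y -> le_Nd x y -> y = x].

End Semigroups.

(* Main.v *)
Require Import Defs.
From mathcomp Require Import all_boot all_algebra.
From mathcomp Require Import boolp classical_sets functions cardinality.
From mathcomp Require Import zify.

Local Open Scope classical_set_scope.
Local Open Scope card_scope.

(** Write A = <a1, a2> and B = <b1, b2>. An element of S is a point (x, y)
    for which some t gives x - t in A and y - t in B; membership in S is thus
    a statement about two numerical semigroups ([generated_planeE]).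

    Embedding dimension 5 excludes 1 from A and from B: otherwise one of the
    five generators would be a multiple of another, whereas any generating set
    contains the minimal one, hence has at least five elements
    ([minimal_generators_sub], [not_generated_by_others]). So A and B are
    cofinite proper subsets of N, with Frobenius numbers F and G.

    The point (F + 1, 1) is a gap: t = 0 fails because 1 is not in B, and
    t = 1 fails because F is not in A. Symmetrically (1, G + 1) is a gap. Gaps
    are bounded, so each of these two lies below a maximal gap. One and the
    same maximal gap cannot serve for both: its coordinates would exceed F and
    G respectively, and it would be in A x B, hence in S. *)

(** * Minimal generating sets *)

Section MinimalGenerators.
Local Open Scope ring_scope.
Variable d : nat.
Implicit Types (A B M S : set 'rV[nat]_d) (x y z : 'rV[nat]_d).

Lemma submonoid_generated A : submonoid (generated A).
Proof.
split=> [M [[M0 _] _]//|x y Ax Ay M [sM AM]].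
by apply: sM.2; [apply: Ax | apply: Ay].
Qed.

Lemma generated0 A : generated A 0.
Proof. exact: (submonoid_generated A).1. Qed.

Lemma generatedD A x y : generated A x -> generated A y -> generated A (x + y).
Proof. exact: (submonoid_generated A).2. Qed.

Lemma generatedMn A x n : generated A x -> generated A (x *+ n).
Proof.
move=> Ax; elim: n => [|n IH]; first by rewrite GRing.mulr0n; exact: generated0.
by rewrite GRing.mulrS; exact: generatedD.
Qed.

Lemma sub_generated A : A `<=` generated A.
Proof. by move=> x Ax M [_]; apply. Qed.

Lemma generated_min A M : submonoid M -> A `<=` M -> generated A `<=` M.
Proof. by move=> sM AM x; apply; split. Qed.

Lemma generated_sub A B : A `<=` generated B -> generated A `<=` generated B.
Proof. exact: generated_min (submonoid_generated B). Qed.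

Lemma rV_nat_addI x : injective (+%R x).
Proof.
move=> y z /rowP e; apply/rowP => i; have := e i.
by rewrite !mxE => /addnI.
Qed.

Lemma rV_nat_addr_eq0 x y : x + y = 0 -> y = 0.
Proof.
move=> /rowP e; apply/rowP => i; have /eqP := e i.
by rewrite !mxE addn_eq0 => /andP[_ /eqP].
Qed.

Lemma generated_head A x : generated A x ->
  x = 0 \/ exists g y, [/\ A g, g <> 0, generated A y & x = g + y].
Proof.
move=> Ax; suff [] : generated A x /\
  (x = 0 \/ exists g y, [/\ A g, g <> 0, generated A y & x = g + y]) by [].
move: x Ax; apply: generated_min; last first.
  move=> g Ag; split; first exact: sub_generated.
  have [->|/eqP g0] := eqVneq g 0; first by left.
  by right; exists g, 0; rewrite GRing.addr0; split=> //; exact: generated0.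
split; first by split; [exact: generated0 | left].
move=> x y [Ax hx] [Ay hy]; split; first exact: generatedD.
case: hx => [->|[g [z [Ag g0 Az ->]]]]; first by rewrite GRing.add0r.
by right; exists g, (z + y); rewrite GRing.addrA; split=> //; exact: generatedD.
Qed.

(** Stated so that cancellation can exclude the second case: no degree or
    order on N^d is involved in proving minimal generators irreducible. *)
Lemma generated_without A a x : generated A x ->
  generated (A `\ a) x \/ exists2 y, generated A y & x = a + y.
Proof.
move=> Ax; suff [] : generated A x /\
  (generated (A `\ a) x \/ exists2 y, generated A y & x = a + y) by [].
move: x Ax; apply: generated_min; last first.
  move=> g Ag; split; first exact: sub_generated.
  have [->|/eqP ga] := eqVneq g a; last by left; exact: sub_generated.
  by right; exists 0; [exact: generated0 | rewrite GRing.addr0].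
split; first by split; [exact: generated0 | left; exact: generated0].
move=> x y [Ax hx] [Ay hy]; split; first exact: generatedD.
case: hx => [hx|[z Az ->]]; last first.
  by right; exists (z + y); [exact: generatedD | rewrite GRing.addrA].
case: hy => [hy|[z Az ->]]; first by left; exact: generatedD.
by right; exists (x + z); [exact: generatedD | rewrite GRing.addrCA].
Qed.

Lemma minimal_generators_notin S A a :
  minimal_generators S A -> A a -> ~ generated (A `\ a) a.
Proof.
move=> [AS minA] Aa gen_a.
have : A `\ a = A.
  apply: minA; first exact: subDsetl.
  rewrite -AS; apply/seteqP; split.
    by apply: generated_sub => x [Ax _]; exact: sub_generated.
  apply: generated_sub => x Ax.
  by have [->//|/eqP xa] := eqVneq x a; exact: sub_generated.
by move=> /seteqP[_ /(_ a Aa)] [_]; apply.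
Qed.

(** Minimal generators are irreducible in S: if a = x + y with y nonzero, the
    expansion of x cannot use a, by cancellation, and likewise for y when x is
    nonzero, so a is redundant. An irreducible element of S belongs to every
    generating set. *)
Lemma minimal_generators_sub S A B :
  minimal_generators S A -> generated B = S -> A `<=` B.
Proof.
move=> minA BS a Aa; have notin := minimal_generators_notin S A a minA Aa.
have AS := minA.1.
have avoids_a x y : generated A x -> a = x + y -> y <> 0 -> generated (A `\ a) x.
  move=> Ax axy y0; case: (generated_without A a x Ax) => // -[z _ xz].
  case: y0; apply: (rV_nat_addr_eq0 z); apply: (rV_nat_addI a).
  by rewrite GRing.addrA -xz -axy GRing.addr0.
have : generated B a by rewrite BS -AS; exact: sub_generated.
case/generated_head => [a0|[g [y [Bg g0 By agy]]]].
  by case: notin; rewrite {2}a0; exact: generated0.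
have [y0|/eqP y0] := eqVneq y 0; first by rewrite agy y0 GRing.addr0.
case: notin; rewrite {2}agy; apply: generatedD.
  by apply: (avoids_a g y) => //; rewrite AS -BS; exact: sub_generated.
apply: (avoids_a y g) => //; first by rewrite AS -BS.
by rewrite GRing.addrC.
Qed.

(** The minimal generating set has e elements and lies in every generating
    set. *)
Lemma embedding_dimension_le (s : seq 'rV[nat]_d) e :
  embedding_dimension (generated [set` s]) e -> (e <= size s)%N.
Proof.
move=> [A [minA cardA]]; rewrite -card_le_II.
have As : A `<=` [set` s] by exact: minimal_generators_sub minA _.
apply: (@card_le_trans _ _ _ A); first by rewrite card_eq_le in cardA; case/andP: cardA.
apply: (card_le_trans (subset_card_le As)).
have -> : [set` s] = nth 0 s @` `I_(size s).
  apply/seteqP; split=> [x /= xs|_ [i /= lt_i <-]]; last exact: mem_nth.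
  by exists (index x s); [rewrite /= index_mem | rewrite nth_index].
exact: card_image_le.
Qed.

Lemma not_generated_by_others (s : seq 'rV[nat]_d) x :
  embedding_dimension (generated [set` x :: s]) (size s).+1 ->
  ~ generated [set` s] x.
Proof.
move=> edim sx; suff gen_s : generated [set` x :: s] = generated [set` s].
  by move: edim; rewrite gen_s => /embedding_dimension_le; rewrite ltnn.
apply/seteqP; split; apply: generated_sub => y /=.
  by rewrite inE => /orP[/eqP ->//|ys]; exact: sub_generated.
by move=> ys; apply: sub_generated; rewrite /= inE ys orbT.
Qed.

End MinimalGenerators.

(** * Maximal gaps *)

Lemma ex_max_nat (P : nat -> Prop) N : (exists n, P n) ->
  (forall n, P n -> (n <= N)%N) ->
  exists2 m, P m & forall n, P n -> (n <= m)%N.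
Proof.
move=> [n0 Pn0] leN.
have exP : exists n, `[< P n >] by exists n0; exact/asboolP.
have bP n : `[< P n >] -> (n <= N)%N by move/asboolP; exact: leN.
case: (ex_maxnP exP bP) => m /asboolP Pm maxm.
by exists m => // n Pn; apply: maxm; exact/asboolP.
Qed.

Section MaximalGaps.
Local Open Scope ring_scope.
Variable d : nat.
Implicit Types (S : set 'rV[nat]_d) (v w : 'rV[nat]_d).

Definition weight v : nat := (\sum_i v ord0 i)%N.

Lemma weightD v w : weight (v + w) = (weight v + weight w)%N.
Proof. by rewrite -big_split /=; apply: eq_bigr => i _; rewrite mxE. Qed.

Lemma weight_eq0 v : weight v = 0%N -> v = 0.
Proof.
move=> /eqP; rewrite sum_nat_eq0 => /forallP v0.
by apply/rowP => i; rewrite !mxE; apply/eqP; exact: v0.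
Qed.

(** A gap of largest weight among those above v is maximal, since a proper
    increase raises the weight. *)
Lemma FA_above S N v : (forall w, gaps S w -> (weight w <= N)%N) ->
  gaps S v -> exists2 m, FA S m & le_Nd v m.
Proof.
move=> leN gv.
pose P n := exists w, [/\ gaps S w, le_Nd v w & weight w = n].
have exP : exists n, P n.
  by exists (weight v), v; split=> //; exists 0; rewrite GRing.addr0.
have bP n : P n -> (n <= N)%N by move=> [w [gw _ <-]]; exact: leN.
have [_ [m [gm vm <-]] maxm] := ex_max_nat P N exP bP.
exists m => //; split=> // y gy [z yE]; rewrite yE.
suff -> : z = 0 by rewrite GRing.addr0.
apply: weight_eq0.
have : (weight (m + z) <= weight m)%N.
  apply: maxm; exists (m + z); split=> //; first by rewrite -yE.
    by case: vm => u ->; exists (u + z); rewrite GRing.addrA.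
by rewrite weightD -[leqRHS]addn0 leq_add2l leqn0 => /eqP.
Qed.

End MaximalGaps.

(** * Numerical semigroups on two generators *)

Definition numsg a b : set nat := [set n | exists i j, n = (i * a + j * b)%N].

Lemma numsg0 a b : numsg a b 0%N.
Proof. by exists 0%N, 0%N. Qed.

Lemma numsgD a b m n : numsg a b m -> numsg a b n -> numsg a b (m + n)%N.
Proof.
by move=> [i [j ->]] [k [l ->]]; exists (i + k)%N, (j + l)%N; lia.
Qed.

Lemma numsg1 a b : numsg a b 1%N -> a = 1%N \/ b = 1%N.
Proof.
move=> [i [j /esym ij]].
have : (i * a == 1) || (j * b == 1) by apply/orP; lia.
by rewrite !muln_eq1 => /orP[] /andP[_ /eqP]; [left | right].
Qed.

(** Subtract from n the representative x, modulo a * b, of the class that is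
    0 modulo a and n modulo b: the difference is a multiple of b. *)
Lemma numsg_cofinite a b n : (0 < a)%N -> (0 < b)%N -> gcdn a b = 1%N ->
  (a * b <= n)%N -> numsg a b n.
Proof.
move=> a0 b0 gcd_ab le_n; have co_ab : coprime a b by exact/eqP.
pose x := (chinese a b 0 n %% (a * b))%N.
have xn : (x <= n)%N by rewrite (leq_trans _ le_n)// ltnW// ltn_mod muln_gt0 a0.
have /dvdnP[i xE] : (a %| x)%N.
  by rewrite /dvdn /x modn_dvdm ?dvdn_mulr// chinese_modl// mod0n.
have /dvdnP[j nxE] : (b %| n - x)%N.
  by rewrite -eqn_mod_dvd// /x modn_dvdm ?dvdn_mull// chinese_modr.
by exists i, j; rewrite -xE -nxE subnKC.
Qed.

Lemma numsg_frobenius a b : (0 < a)%N -> (0 < b)%N -> gcdn a b = 1%N ->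
  ~ numsg a b 1%N ->
  exists2 f, ~ numsg a b f & forall n, (f < n)%N -> numsg a b n.
Proof.
move=> a0 b0 gcd_ab not1.
have exP : exists n, ~ numsg a b n by exists 1%N.
have bP n : ~ numsg a b n -> (n <= a * b)%N.
  by apply: contra_notT; rewrite -ltnNge => /ltnW; exact: numsg_cofinite.
have [f Nf maxf] := ex_max_nat (fun n => ~ numsg a b n) (a * b)%N exP bP.
exists f => // n; rewrite ltnNge => /negP lt_fn.
by apply: contrapT => /maxf.
Qed.

(** * The semigroup in the plane *)

Section Vec2.
Local Open Scope ring_scope.

Lemma vec2_0 x y : (vec2 x y) ord0 ord0 = x.
Proof. by rewrite mxE. Qed.

Lemma vec2_1 x y : (vec2 x y) ord0 (lift ord0 ord0) = y.
Proof. by rewrite mxE. Qed.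

Lemma vec2_eta (v : 'rV[nat]_2) :
  v = vec2 (v ord0 ord0) (v ord0 (lift ord0 ord0)).
Proof.
apply/rowP => i; rewrite mxE; case: eqP => [->//|].
by case: (unliftP ord0 i) => [j ->|->//] _; rewrite (ord1 j).
Qed.

Lemma vec2D x y z w : vec2 x y + vec2 z w = vec2 (x + z)%N (y + w)%N.
Proof. by apply/rowP => i; rewrite !mxE; case: ifP. Qed.

Lemma vec2_00 : vec2 0 0 = 0.
Proof. by apply/rowP => i; rewrite !mxE; case: ifP. Qed.

Lemma vec2Mn x y n : vec2 x y *+ n = vec2 (n * x)%N (n * y)%N.
Proof.
elim: n => [|n IH]; first by rewrite GRing.mulr0n !mul0n vec2_00.
by rewrite GRing.mulrS IH vec2D !mulSn.
Qed.

Lemma weight_vec2 x y : weight 2 (vec2 x y) = (x + y)%N.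
Proof. by rewrite /weight big_ord_recl big_ord1 vec2_0 vec2_1. Qed.

Lemma le_Nd_vec2 x y z w :
  le_Nd (vec2 x y) (vec2 z w) -> (x <= z)%N /\ (y <= w)%N.
Proof.
move=> [v]; rewrite (vec2_eta v) vec2D => e.
by rewrite -(vec2_0 z w) -{2}(vec2_1 z w) e vec2_0 vec2_1 !leq_addr.
Qed.

End Vec2.

Section Plane.
Local Open Scope ring_scope.
Variables a1 a2 b1 b2 : nat.

Definition plane_gens : set 'rV[nat]_2 :=
  [set vec2 a1 0; vec2 a2 0; vec2 0 b1; vec2 0 b2; vec2 1 1].

Lemma generated_planeE x y : generated plane_gens (vec2 x y) <->
  exists t u w, [/\ numsg a1 a2 u, numsg b1 b2 w, x = (u + t)%N & y = (w + t)%N].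
Proof.
split=> [gen|[t [_ [_ [[i [j ->]] [k [l ->]] -> ->]]]]]; last first.
  have -> : vec2 (i * a1 + j * a2 + t) (k * b1 + l * b2 + t) =
      vec2 a1 0 *+ i + vec2 a2 0 *+ j + vec2 0 b1 *+ k + vec2 0 b2 *+ l +
      vec2 1 1 *+ t.
    by rewrite !vec2Mn !vec2D; congr vec2; lia.
  by do !apply: generatedD; apply: generatedMn; apply: sub_generated;
     rewrite /plane_gens /=; tauto.
pose M : set 'rV[nat]_2 := [set v | exists t u w, [/\ numsg a1 a2 u,
  numsg b1 b2 w & v = vec2 (u + t) (w + t)]].
suff : M (vec2 x y).
  move=> [t [u [w [Au Bw e]]]]; exists t, u, w; split=> //.
    by rewrite -(vec2_0 x y) e vec2_0.
  by rewrite -(vec2_1 x y) e vec2_1.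
move: gen; apply: generated_min => [|v].
  split; first by exists 0%N, 0%N, 0%N; rewrite vec2_00; split=> //; exact: numsg0.
  move=> _ _ [t [u [w [Au Bw ->]]]] [t' [u' [w' [Au' Bw' ->]]]].
  exists (t + t')%N, (u + u')%N, (w + w')%N; split; try exact: numsgD.
  by rewrite vec2D; congr vec2; lia.
have A0 := numsg0 a1 a2; have B0 := numsg0 b1 b2.
have gen1 a b : numsg a b a by exists 1%N, 0%N; lia.
have gen2 a b : numsg a b b by exists 0%N, 1%N; lia.
rewrite /plane_gens /= => -[[[[]|]|]|] ->.
- by exists 0%N, a1, 0%N; rewrite !addn0.
- by exists 0%N, a2, 0%N; rewrite !addn0.
- by exists 0%N, 0%N, b1; rewrite !addn0.
- by exists 0%N, 0%N, b2; rewrite !addn0.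
- by exists 1%N, 0%N, 0%N.
Qed.

(** If 1 is in <a1, a2>, one of a1, a2 is 1, and the generator on the x-axis
    coming from the other one is redundant; likewise on the y-axis. *)
Lemma plane_numsg1 : embedding_dimension (generated plane_gens) 5 ->
  ~ numsg a1 a2 1%N /\ ~ numsg b1 b2 1%N.
Proof.
move=> edim.
have irredundant x s : size s = 4%N ->
    x :: s =i [:: vec2 a1 0; vec2 a2 0; vec2 0 b1; vec2 0 b2; vec2 1 1] ->
    ~ generated [set` s] x.
  move=> size_s sE; apply: not_generated_by_others; rewrite size_s.
  suff <- : plane_gens = [set` x :: s] by [].
  apply/seteqP; split=> v; rewrite /= sE !inE.
    by move=> [[[[]|]|]|] ->; rewrite eqxx ?orbT.
  by move=> /or4P[/eqP|/eqP|/eqP|/orP[]/eqP] ->; rewrite /plane_gens /=; tauto.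
have mul_x n s : vec2 1 0 \in s -> generated [set` s] (vec2 n 0).
  have -> : vec2 n 0 = vec2 1 0 *+ n by rewrite vec2Mn muln1 muln0.
  by move=> xs; apply: generatedMn; exact: sub_generated.
have mul_y n s : vec2 0 1 \in s -> generated [set` s] (vec2 0 n).
  have -> : vec2 0 n = vec2 0 1 *+ n by rewrite vec2Mn muln1 muln0.
  by move=> ys; apply: generatedMn; exact: sub_generated.
split=> /numsg1[] is1.
- apply: (irredundant (vec2 a2 0) [:: vec2 a1 0; vec2 0 b1; vec2 0 b2; vec2 1 1]).
  + by [].
  + by move=> v; rewrite !inE; do 5!case: (v == _).
  + by apply: mul_x; rewrite is1 inE eqxx.
- apply: (irredundant (vec2 a1 0) [:: vec2 a2 0; vec2 0 b1; vec2 0 b2; vec2 1 1]).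
  + by [].
  + by move=> v; rewrite !inE; do 5!case: (v == _).
  + by apply: mul_x; rewrite is1 inE eqxx.
- apply: (irredundant (vec2 0 b2) [:: vec2 0 b1; vec2 a1 0; vec2 a2 0; vec2 1 1]).
  + by [].
  + by move=> v; rewrite !inE; do 5!case: (v == _).
  + by apply: mul_y; rewrite is1 inE eqxx.
- apply: (irredundant (vec2 0 b1) [:: vec2 0 b2; vec2 a1 0; vec2 a2 0; vec2 1 1]).
  + by [].
  + by move=> v; rewrite !inE; do 5!case: (v == _).
  + by apply: mul_y; rewrite is1 inE eqxx.
Qed.

Variables f g : nat.
Hypothesis (Nf : ~ numsg a1 a2 f) (gt_f : forall n, (f < n)%N -> numsg a1 a2 n).
Hypothesis (Ng : ~ numsg b1 b2 g) (gt_g : forall n, (g < n)%N -> numsg b1 b2 n).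

Lemma generated_plane_gt x y : (f < x)%N -> (g < y)%N ->
  generated plane_gens (vec2 x y).
Proof.
move=> fx gy; apply/generated_planeE; exists 0%N, x, y; rewrite !addn0.
by split=> //; [exact: gt_f | exact: gt_g].
Qed.

(** A heavy point has both coordinates beyond the Frobenius numbers, or it
    is so far from the diagonal that subtracting its smaller coordinate
    leaves a point on an axis beyond the Frobenius number there. *)
Lemma gaps_plane_bounded v : gaps (generated plane_gens) v ->
  (weight 2 v <= (f + g).*2)%N.
Proof.
rewrite (vec2_eta v) weight_vec2.
move: (v _ _) (v _ _) => y x; apply: contra_notT; rewrite -ltnNge => heavy.
have [fx|xf] := ltnP f x; have [gy|yg] := ltnP g y; try lia.
- exact: generated_plane_gt.
- apply/generated_planeE; exists y, (x - y)%N, 0%N; split; try lia.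
  + by apply: gt_f; lia.
  + exact: numsg0.
- apply/generated_planeE; exists x, 0%N, (y - x)%N; split; try lia.
  + exact: numsg0.
  + by apply: gt_g; lia.
Qed.

(** Subtracting (0, 0) or (1, 1), the only multiples of (1, 1) below
    (f + 1, 1), leaves the second coordinate 1 or the first coordinate f. *)
Lemma gaps_plane_x : ~ numsg b1 b2 1%N ->
  gaps (generated plane_gens) (vec2 f.+1 1).
Proof.
move=> not1 /generated_planeE[t [u [w [Au Bw fE wE]]]].
have [t0|t1] : t = 0%N \/ t = 1%N by lia.
  by apply: not1; have -> : 1%N = w by lia.
by apply: Nf; have -> : f = u by lia.
Qed.

Lemma gaps_plane_y : ~ numsg a1 a2 1%N ->
  gaps (generated plane_gens) (vec2 1 g.+1).
Proof.
move=> not1 /generated_planeE[t [u [w [Au Bw uE gE]]]].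
have [t0|t1] : t = 0%N \/ t = 1%N by lia.
  by apply: not1; have -> : 1%N = u by lia.
by apply: Ng; have -> : g = w by lia.
Qed.

End Plane.

(** * Two maximal gaps *)

Lemma card_ge2 {T : Type} (A : set T) x y : A x -> A y -> x <> y -> `I_2 #<= A.
Proof.
move=> Ax Ay xy.
pose h i := if i == 0%N then x else y.
have h_inj : {in `I_2 &, injective h}.
  move=> [|[|i]] [|[|j]]; rewrite !inE //= /h /= => _ _ // e.
  by case: xy.
have := inj_card_eq h_inj; rewrite card_eq_le => /andP[_ le2].
apply: (card_le_trans le2); apply: subset_card_le => _ [i _ <-].
by rewrite /h; case: ifP.
Qed.

Theorem lemma2p2 (a1 a2 b1 b2 : nat) (S : set 'rV[nat]_2)
  (a1_gt0 : (0 < a1)%N) (a2_gt0 : (0 < a2)%N)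
  (b1_gt0 : (0 < b1)%N) (b2_gt0 : (0 < b2)%N)
  (gcd_a : gcdn a1 a2 = 1%N) (gcd_b : gcdn b1 b2 = 1%N)
  (defS : S = generated [set vec2 a1 0; vec2 a2 0; vec2 0 b1; vec2 0 b2;
                             vec2 1 1])
  (edim_S : embedding_dimension S 5) :
  `I_2 #<= FA S.
Proof.
rewrite {}defS in edim_S *; rewrite -/(plane_gens a1 a2 b1 b2) in edim_S *.
have [A1 B1] := plane_numsg1 a1 a2 b1 b2 edim_S.
have [f Nf gt_f] := numsg_frobenius a1 a2 a1_gt0 a2_gt0 gcd_a A1.
have [g Ng gt_g] := numsg_frobenius b1 b2 b1_gt0 b2_gt0 gcd_b B1.
have bounded := gaps_plane_bounded a1 a2 b1 b2 f g gt_f gt_g.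
(* The two gaps (f + 1, 1) and (1, g + 1) have no common maximal gap above
   them: it would exceed f and g coordinatewise. *)
have [m FAm le_m] := FA_above 2 _ _ _ bounded
  (gaps_plane_x a1 a2 b1 b2 f Nf B1).
have [n FAn le_n] := FA_above 2 _ _ _ bounded
  (gaps_plane_y a1 a2 b1 b2 g Ng A1).
apply: (card_ge2 _ m n) => // mn; case: (FAm) => gap_m _; apply: gap_m.
move: le_m le_n; rewrite -mn (vec2_eta m).
move=> /le_Nd_vec2[lt_f _] /le_Nd_vec2[_ lt_g].
by apply: (generated_plane_gt _ _ _ _ f g).
Qed.
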